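(* Let $\mathcal H$ be a real Hilbert space, $S\subset\mathcal H$ a nonempty closed set, $x\in\mathcal H$, and $\varepsilon,\eta>0$. Put $\varepsilon':=\varepsilon+2\eta(d_S(x)+\sqrt\varepsilon)+\eta^2$. Then, for each $z\in\operatorname{proj}_S^{\varepsilon,\eta}(x)$, there exists $v\in\operatorname{proj}_S^{\varepsilon'}(x)$ such that $\|z-v\|<2\sqrt{\varepsilon'}+\eta$ and $$x-z\in\big(4\sqrt{\varepsilon'}+d_S(x)\big)\,\partial_Pd_S(v)+\big(3\sqrt{\varepsilon'}+\eta\big)\mathbb B.$$
   Context: $\mathbb B$ is the closed unit ball of $\mathcal H$; $d_S(x)=\inf_{z\in S}\|x-z\|$. For $\varepsilon>0$, $\operatorname{proj}_S^{\varepsilon}(x):=\{z\in S:\|x-z\|^2<d_S^2(x)+\varepsilon\}$. For $\varepsilon,\eta>0$, $\operatorname{proj}_S^{\varepsilon,\eta}(x):=\{z\in S_\eta:\|x-z\|^2<d_S^2(x)+\varepsilon\}$, where $S_\eta$ is any (arbitrarily chosen) closed set with $S\subset S_\eta\subset S+\eta\mathbb B$. The proximal subdifferential $\partial_Pg(v)$ of a lower semicontinuous function $g\colon\mathcal H\to\mathbb R\cup\{+\infty\}$ at a point $v$ with $g(v)<+\infty$ is the set of $\zeta\in\mathcal H$ for which there are $\sigma\ge0$ and $r>0$ such that $g(y)\ge g(v)+\langle\zeta,y-v\rangle-\sigma\|y-v\|^2$ for all $y$ with $\|y-v\|<r$. *)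

(* Defs.v *)
From HB Require Import structures.
From mathcomp Require Import all_boot all_order all_algebra.
From mathcomp Require Import all_classical all_reals all_analysis.

Set Implicit Arguments.
Unset Strict Implicit.
Unset Printing Implicit Defensive.

Import Order.TTheory GRing.Theory Num.Theory.
Import numFieldNormedType.Exports.

Local Open Scope classical_set_scope.
Local Open Scope ring_scope.

Definition set_add (V : zmodType) (A B : set V) : set V :=
  [set a + b | a in A & b in B].

Definition set_scale (R : pzRingType) (V : lmodType R) (c : R) (A : set V) :
  set V := [set c *: a | a in A].

Definition unit_ball (R : realType) (H : normedModType R) : set H :=
  closed_ball (0 : H) 1.
Arguments unit_ball {R} H.

(* The real-valued [inf] is junk on the empty set: use with [S !=set0]. *)
Definition dist_set (R : realType) (H : normedModType R) (S : set H) (x : H)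
  : R := inf [set `|x - z| | z in S].

Definition proj_eps (R : realType) (H : normedModType R) (S : set H)
    (eps : R) (x : H) : set H :=
  [set z | S z /\ `|x - z| ^+ 2 < dist_set S x ^+ 2 + eps].

(* The closed sets that may be chosen as [S_eta]. *)
Definition is_approx (R : realType) (H : normedModType R) (S : set H)
    (eta : R) (Seta : set H) : Prop :=
  [/\ closed Seta, S `<=` Seta &
      Seta `<=` set_add S (set_scale eta (unit_ball H))].

(* [proj_S^{eps,eta}(x)] for the chosen [Seta]; the distance is the one to
   [S], not the one to [Seta]. *)
Definition proj_eps_eta (R : realType) (H : normedModType R)
    (S Seta : set H) (eps : R) (x : H) : set H :=
  [set z | Seta z /\ `|x - z| ^+ 2 < dist_set S x ^+ 2 + eps].

(* Meant for lower semicontinuous [g] that do not take the value [-oo]; empty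
   at the points where [g] is [+oo]. *)
Definition prox_subdiff (R : realType) (H : normedModType R)
    (ip : {dot H for idfun}) (g : H -> \bar R) (v : H) : set H :=
  [set zeta | (g v < +oo)%E /\
    exists sigma r : R, [/\ 0 <= sigma, 0 < r &
      forall y : H, `|y - v| < r ->
        (g v + (ip zeta (y - v) - sigma * `|y - v| ^+ 2)%:E <= g y)%E]].

(* Main.v *)
Require Import Defs.
From HB Require Import structures.
From mathcomp Require Import all_boot all_order all_algebra.
From mathcomp Require Import all_classical all_reals all_analysis.
From mathcomp Require Import ring lra.

Set Implicit Arguments.
Unset Strict Implicit.
Unset Printing Implicit Defensive.

Import Order.TTheory GRing.Theory Num.Theory.
Import numFieldNormedType.Exports.

Local Open Scope classical_set_scope.
Local Open Scope ring_scope.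

(** The point [z] lies within [eta] of some [z0] in [S], and [eps'] is chosen
    so that [z0] is an [eps']-projection of [x] on [S]: expand
    [(|x - z| + eta)^2] using [|x - z| < d_S(x) + sqrt eps]. The error
    [z - z0] costs [eta] in each of the two estimates, so it remains to treat
    an [eps]-projection [z] that lies in [S] itself
    ([proj_eps_prox_subdiff]).

    This is a smooth variational principle for [w |-> |x - w|^2] on [S]. In a
    Hilbert space, adding a perturbation [|y - w|^2] gives, up to a constant,
    [2 |q - w|^2] with [q] the midpoint of [x] and [y], so minimizing the
    perturbed function on [S] amounts to finding a nearest point of [S] to
    [q]. Hence the principle reduces to the density of the points that have a
    nearest point ([nearest_point_dense]): take such a [q] close to the
    midpoint of [x] and [z], let [v] be a nearest point to it, and put
    [y = 2 q - x], which is close to [z]. Comparing the perturbed function at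
    [v] and at [z] bounds both [|x - v|] and [|y - v|], and [2 (q - v)] equals
    [(x - v) + (y - v)], which differs from [x - z] by
    [(y - v) + (z - v)]. Since [v] is nearest to [q], the vector [2 (q - v)] is
    a proximal normal to [S] at [v]; scaled into the unit ball, it becomes a
    proximal subgradient of the distance function ([prox_subdiff_dist_set]).

    Density is obtained by Baire's theorem. Moving [p] a small fraction [t] of
    the way to an almost nearest point [s] favours [s] over its competitors:
    by the convexity identity [sqr_norm_convex], the almost nearest points to
    the displaced point are close to [s]. So the points all of whose almost
    nearest points in [S] lie in a ball of radius [e] form a dense open set
    ([open_near_min_within], [dense_near_min_within]). At a point that belongs
    to these sets for all [e], minimizing sequences are Cauchy
    ([nearest_point_of_near_min_within]). *)

(** * The distance function *)

Lemma dist_set_le (R : realType) (H : normedModType R) (S : set H) (p s : H) :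
  S s -> dist_set S p <= `|p - s|.
Proof. by move=> Ss; apply: ge_inf; [exists 0 => _ [z _ <-] | exists s]. Qed.

Lemma dist_set_ge0 (R : realType) (H : normedModType R) (S : set H) (p : H) :
  S !=set0 -> 0 <= dist_set S p.
Proof.
by move=> [s Ss]; apply: lb_le_inf => [|_ [z _ <-] //]; exists `|p - s|, s.
Qed.

Lemma dist_set_approx (R : realType) (H : normedModType R) (S : set H)
    (p : H) (kappa : R) :
  S !=set0 -> 0 < kappa ->
  exists2 s, S s & `|p - s| < dist_set S p + kappa.
Proof.
move=> [s Ss] kappa_gt0.
have [|_ [z Sz <-] zp] := @inf_adherent _ [set `|p - z| | z in S] _ kappa_gt0.
  by split; [exists `|p - s|, s | exists 0 => _ [z _ <-]].
by exists z.
Qed.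

Lemma dist_set_lipschitz (R : realType) (H : normedModType R) (S : set H)
    (p q : H) :
  S !=set0 -> dist_set S p <= dist_set S q + `|p - q|.
Proof.
move=> S0; rewrite -lerBlDr; apply: lb_le_inf.
  by case: S0 => s Ss; exists `|q - s|, s.
move=> _ [s Ss <-]; have := dist_set_le p Ss.
by have := ler_distD q p s; lra.
Qed.

(** * Inner product identities *)

Lemma sqr_norm_sub (R : realType) (H : normedModType R)
    (ip : {dot H for idfun}) (ip_norm : forall u : H, ip u u = `|u| ^+ 2)
    (u w : H) :
  `|u - w| ^+ 2 = `|u| ^+ 2 - 2 * ip u w + `|w| ^+ 2.
Proof.
by rewrite -!ip_norm hnormB /= expr0 mul1r; ring.
Qed.

Lemma sqr_norm_add (R : realType) (H : normedModType R)
    (ip : {dot H for idfun}) (ip_norm : forall u : H, ip u u = `|u| ^+ 2)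
    (u w : H) :
  `|u + w| ^+ 2 = `|u| ^+ 2 + 2 * ip u w + `|w| ^+ 2.
Proof.
by rewrite -{1}[w]opprK (sqr_norm_sub ip_norm) normrN linearNr; ring.
Qed.

Lemma ip_le_norm (R : realType) (H : normedModType R)
    (ip : {dot H for idfun}) (ip_norm : forall u : H, ip u u = `|u| ^+ 2)
    (u w : H) :
  ip u w <= `|u| * `|w|.
Proof.
have : `|u + w| ^+ 2 <= (`|u| + `|w|) ^+ 2.
  by rewrite ler_sqr ?nnegrE ?addr_ge0// ler_normD.
by rewrite (sqr_norm_add ip_norm); lra.
Qed.

(** Strong convexity of the squared norm, as an identity: the last term is the
    gain that makes almost nearest points cluster. *)
Lemma sqr_norm_convex (R : realType) (H : normedModType R)
    (ip : {dot H for idfun}) (ip_norm : forall u : H, ip u u = `|u| ^+ 2)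
    (t : R) (u w : H) :
  `|u + t *: (w - u)| ^+ 2 =
  (1 - t) * `|u| ^+ 2 + t * `|w| ^+ 2 - t * (1 - t) * `|u - w| ^+ 2.
Proof.
rewrite (sqr_norm_add ip_norm) linearZr_LR /= linearBr /= ip_norm normrZ.
rewrite exprMn real_normK ?num_real// distrC !(sqr_norm_sub ip_norm); ring.
Qed.

(** * Density of the points that have a nearest point *)

(** The slack [kappa] is allowed to depend on the point, which makes the set
    open. *)
Definition near_min_within (R : realType) (H : normedModType R) (S : set H)
    (e : R) : set H :=
  [set p | exists s kappa, 0 < kappa /\
     forall y, S y -> `|p - y| < dist_set S p + kappa -> `|s - y| < e].

(** The distance function is 1-Lipschitz, so a point at distance less than
    [kappa / 4] from [p] inherits the property with slack [kappa / 4]. *)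
Lemma open_near_min_within (R : realType) (H : normedModType R) (S : set H)
    (e : R) :
  S !=set0 -> open (near_min_within S e).
Proof.
move=> S0; rewrite openE => p [s [kappa [kappa_gt0 smin]]].
apply/nbhs_ballP; exists (kappa / 4); first by rewrite /= divr_gt0.
move=> q; rewrite -ball_normE /= => pq; exists s, (kappa / 4).
split=> [|y Sy qy]; first by rewrite divr_gt0.
apply: smin => //; have := ler_distD q p y.
by have := dist_set_lipschitz q p S0; rewrite (distrC q p); lra.
Qed.

(** With [s] almost nearest to [p] and [q = p + t (s - p)], an almost nearest
    point [y] to [q] satisfies, by the convexity identity,
    [t |s - y|^2 <= (1 - t) (|p - s|^2 - |p - y|^2) + O(kappa)], and the
    bracket is itself [O(kappa)]; so [kappa] is chosen small against
    [t e^2]. *)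
Lemma dense_near_min_within (R : realType) (H : normedModType R)
    (ip : {dot H for idfun}) (ip_norm : forall u : H, ip u u = `|u| ^+ 2)
    (S : set H) (e : R) :
  S !=set0 -> 0 < e -> dense (near_min_within S e).
Proof.
move=> S0 e_gt0 O [p Op]; rewrite openE => /(_ p Op)/nbhs_ballP[tau /= tau_gt0].
rewrite -ball_normE => tauO.
set D := dist_set S p; have D_ge0 : 0 <= D := dist_set_ge0 p S0.
(* [t] keeps the displacement [t |s - p| <= t (D + 1)] below [tau]. *)
pose t := tau / (tau + D + 1).
have den_gt0 : 0 < tau + D + 1 by lra.
have t_gt0 : 0 < t by rewrite divr_gt0.
have t_lt1 : t < 1 by rewrite ltr_pdivrMr//; lra.
have tD : t * (D + 1) < tau.
  by rewrite mulrAC ltr_pdivrMr// ltr_pM2l//; lra.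
(* The errors [kappa (2 D + 1)] and [kappa (2 D + 3)] found in [h1] and [h3]
   add up to [kappa (4 D + 4)]. *)
pose kappa := Num.min 1 (t * e ^+ 2 / (4 * D + 4)).
have te_gt0 : 0 < t * e ^+ 2 by rewrite mulr_gt0// exprn_gt0.
have D4_gt0 : 0 < 4 * D + 4 by lra.
have kappa_gt0 : 0 < kappa by rewrite lt_min ltr01 divr_gt0.
have kappa_le1 : kappa <= 1 by rewrite ge_min lexx.
have kappa_le : kappa * (4 * D + 4) <= t * e ^+ 2.
  by rewrite -ler_pdivlMr// ge_min lexx orbT.
have [s Ss ps] := dist_set_approx p S0 kappa_gt0; rewrite -/D in ps.
have n_ge0 := normr_ge0 (p - s).
pose q := p + t *: (s - p).
exists q; split.
  apply: tauO; rewrite /= /q opprD addNKr normrN normrZ gtr0_norm//.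
  rewrite distrC; apply: le_lt_trans tD; rewrite ler_pM2l//; lra.
have qE y : q - y = (p - y) + t *: ((s - y) - (p - y)).
  by rewrite opprB [s - y + _]addrA subrK /q addrAC.
exists s, kappa; split => // y Sy qy.
have qs : dist_set S q <= (1 - t) * `|p - s|.
  apply: le_trans (dist_set_le q Ss) _.
  have -> : q - s = (1 - t) *: (p - s).
    by rewrite qE subrr sub0r scalerN scalerBl scale1r.
  by rewrite normrZ gtr0_norm// subr_gt0.
have := sqr_norm_convex ip_norm t (p - y) (s - y); rewrite -qE.
have -> : p - y - (s - y) = p - s by rewrite opprB addrA subrK.
have qy2 : `|q - y| ^+ 2 < ((1 - t) * `|p - s| + kappa) ^+ 2.
  by rewrite ltr_sqr ?nnegrE//; nra.
have := dist_set_le p Sy; rewrite -/D => py conv.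
rewrite -ltr_sqr ?nnegrE ?(ltW e_gt0)// -(ltr_pM2l t_gt0).
apply: lt_le_trans kappa_le.
have h1 : `|p - s| ^+ 2 - `|p - y| ^+ 2 <= kappa * (2 * D + 1).
  have : D ^+ 2 <= `|p - y| ^+ 2 by rewrite ler_sqr ?nnegrE.
  have : `|p - s| ^+ 2 <= (D + kappa) ^+ 2 
    by rewrite ler_sqr ?nnegrE ?addr_ge0 ?(ltW kappa_gt0)//; exact: ltW.
  have : kappa ^+ 2 <= kappa by nra.
  by nra.
have h2 : (1 - t) * (`|p - s| ^+ 2 - `|p - y| ^+ 2) <= kappa * (2 * D + 1).
  have B_ge0 : 0 <= t * (kappa * (2 * D + 1)).
    apply: mulr_ge0; first exact: ltW.
    by apply: mulr_ge0; [exact: ltW | lra].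
  have := ler_wpM2l (ltW (_ : 0 < 1 - t)) h1; rewrite subr_gt0 => /(_ t_lt1).
  by move: B_ge0; lra.
have h3 : 2 * ((1 - t) * `|p - s|) * kappa + kappa ^+ 2 <= kappa * (2 * D + 3).
  have : (1 - t) * `|p - s| <= D + 1.
    have : 0 <= t * `|p - s| by rewrite mulr_ge0// ltW.
    lra.
  by nra.
by move: qy2 conv h2 h3; lra.
Qed.

(** For each [n], the tail of a minimizing sequence lies in a ball of radius
    [1 / (n + 1)], so the sequence is Cauchy; its limit is in [S], which is
    closed. *)
Lemma nearest_point_of_near_min_within (R : realType)
    (H : completeNormedModType R) (S : set H) (p : H) :
  S !=set0 -> closed S ->
  (forall n : nat, near_min_within S n.+1%:R^-1 p) ->
  exists2 v, S v & `|p - v| <= dist_set S p.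
Proof.
move=> S0 Scl pmin.
have /choice[u uP] n : exists s, S s /\ `|p - s| < dist_set S p + n.+1%:R^-1.
  have [|s Ss ps] := @dist_set_approx _ _ S p n.+1%:R^-1 S0; last by exists s.
  by rewrite invr_gt0.
have ucvg : cvg (u @ \oo).
  apply: cauchy_cvg; apply: cauchy_exP => e e_gt0.
  have [N _ /(_ N (leqnn N)) Ne] := near_infty_natSinv_lt (PosNum e_gt0).
  have [s [kappa [kappa_gt0 smin]]] := pmin N.
  exists s; suff : \forall n \near \oo, ball s e (u n) by [].
  near=> n; rewrite -ball_normE /=; apply: lt_trans Ne.
  have [Sun un] := uP n; apply: smin => //; apply: lt_trans un _.
  rewrite ltrD2l; near: n; exact: near_infty_natSinv_lt (PosNum kappa_gt0).
exists (lim (u @ \oo)).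
  by apply: (closed_cvg S Scl) ucvg; apply: nearW => n; case: (uP n).
apply/ler_addgt0Pr => e e_gt0.
have e2 : 0 < e / 2 by rewrite divr_gt0.
near \oo => n.
have lim_un : `|lim (u @ \oo) - u n| < e / 2.
  by near: n; move/cvgrPdist_lt : ucvg; apply.
have un : `|p - u n| < dist_set S p + e / 2.
  have [_ /lt_trans] := uP n; apply; rewrite ltrD2l.
  by near: n; exact: near_infty_natSinv_lt (PosNum e2).
apply: le_trans (ler_distD (u n) _ _) _; rewrite [e]splitr addrA.
by apply: lerD; apply: ltW => //; rewrite distrC.
Unshelve. all: by end_near. Qed.

Lemma nearest_point_dense (R : realType) (H : completeNormedModType R)
    (ip : {dot H for idfun}) (ip_norm : forall u : H, ip u u = `|u| ^+ 2)
    (S : set H) (p : H) (tau : R) :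
  S !=set0 -> closed S -> 0 < tau ->
  exists q v, [/\ `|p - q| < tau, S v & `|q - v| <= dist_set S q].
Proof.
move=> S0 Scl tau_gt0.
have FP i : open (near_min_within S i.+1%:R^-1) /\
    dense (near_min_within S i.+1%:R^-1).
  split; first exact: open_near_min_within.
  by apply: (dense_near_min_within ip_norm S0); rewrite invr_gt0.
have [||q [pq qmin]] := Baire FP (O := ball p tau).
- by exists p; exact: ballxx.
- exact: ball_open.
have [n|v Sv qv] := nearest_point_of_near_min_within (p := q) S0 Scl.
  exact: qmin.
by exists q, v; split=> //; move: pq; rewrite -ball_normE.
Qed.

(** * Proximal subgradients of the distance function *)

(** That [v] is nearest to [q] means [2 <q - v, s - v> <= |s - v|^2] for [s] in
    [S]. For arbitrary [y], pick [s] in [S] almost nearest to [y] and split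
    [y - v = (y - s) + (s - v)]: as the subgradient has norm at most 1, the
    first part contributes at most about [d_S(y)], while the second is
    quadratic in [|y - v|]. *)
Lemma prox_subdiff_dist_set (R : realType) (H : normedModType R)
    (ip : {dot H for idfun}) (ip_norm : forall u : H, ip u u = `|u| ^+ 2)
    (S : set H) (q v : H) (a : R) :
  S v -> `|q - v| <= dist_set S q -> 0 <= a -> `|a *: (q - v)| <= 1 ->
  prox_subdiff ip (EFin \o dist_set S) v (a *: (q - v)).
Proof.
move=> Sv qv a_ge0 norm_le1; split; first by rewrite /= ltry.
have S0 : S !=set0 by exists v.
have dv0 : dist_set S v = 0.
  apply/le_anti; rewrite (dist_set_ge0 v S0) andbT.
  by have := dist_set_le v Sv; rewrite subrr normr0.
(* [s] is chosen below within [|y - v|^2] of optimal, so that the choice costs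
   a quadratic term and [|s - v| <= 3 |y - v|] as soon as [|y - v| < 1]. *)
exists (1 + 9 * a), 1; split=> // [|y yv]; first by lra.
rewrite /= -EFinD lee_fin dv0 add0r.
have [->|y_neq] := eqVneq y v.
  by rewrite subrr linear0r normr0 expr0n mulr0 subr0 dist_set_ge0.
have r_gt0 : 0 < `|y - v| by rewrite normr_gt0 subr_eq0.
have r2_gt0 : 0 < `|y - v| ^+ 2 by rewrite exprn_gt0.
have [s Ss ys] := dist_set_approx y S0 r2_gt0.
have sv3 : `|s - v| <= 3 * `|y - v|.
  have r2_le : `|y - v| ^+ 2 <= `|y - v| by rewrite expr2 ger_pMl// ltW.
  have := ler_distD y s v; rewrite (distrC s y).
  by have := dist_set_le y Sv; lra.
have normal : 2 * ip (q - v) (s - v) <= `|s - v| ^+ 2.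
  have : `|q - v| ^+ 2 <= `|(q - v) - (s - v)| ^+ 2.
    rewrite ler_sqr ?nnegrE//.
    have -> : q - v - (s - v) = q - s by rewrite opprB addrA subrK.
    exact: le_trans qv (dist_set_le q Ss).
  by rewrite [leRHS](sqr_norm_sub ip_norm); lra.
have -> : y - v = (y - s) + (s - v) by rewrite addrA subrK.
rewrite linearDr /= [y - s + _]addrA subrK.
have h1 : ip (a *: (q - v)) (y - s) <= `|y - s|.
  by apply: le_trans (ip_le_norm ip_norm _ _) _; rewrite ler_piMl.
have h2 : ip (a *: (q - v)) (s - v) <= a * (9 * `|y - v| ^+ 2).
  rewrite linearZl_LR /= ler_wpM2l//.
  have : `|s - v| ^+ 2 <= (3 * `|y - v|) ^+ 2 by rewrite ler_sqr ?nnegrE//; lra.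
  have := sqr_ge0 `|s - v|; rewrite exprMn; lra.
lra.
Qed.

(** * Approximate projections *)

(** The variational principle described at the top, with the midpoint of [x]
    and [z] approximated to within half of the square root of the slack
    [delta = d_S(x)^2 + eps - |x - z|^2]. Then [|y - z|^2 < delta], and
    comparing [v] with [z] gives both [|x - v|^2 < d_S(x)^2 + eps] and
    [|y - v|^2 < eps]. *)
Lemma proj_eps_prox_subdiff (R : realType) (H : completeNormedModType R)
    (ip : {dot H for idfun}) (ip_norm : forall u : H, ip u u = `|u| ^+ 2)
    (S : set H) (x z : H) (eps : R) :
  closed S -> 0 < eps -> proj_eps S eps x z ->
  exists v zeta, [/\ proj_eps S eps x v, `|z - v| < 2 * Num.sqrt eps,
    prox_subdiff ip (EFin \o dist_set S) v zeta &
    `|x - z - (4 * Num.sqrt eps + dist_set S x) *: zeta|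
      <= 3 * Num.sqrt eps].
Proof.
move=> Scl eps_gt0 [Sz xz].
have S0 : S !=set0 by exists z.
set D := dist_set S x in xz *; have D_ge0 : 0 <= D := dist_set_ge0 x S0.
set l := Num.sqrt eps.
have l_gt0 : 0 < l by rewrite sqrtr_gt0.
have l2 : l ^+ 2 = eps by rewrite sqr_sqrtr// ltW.
pose delta := D ^+ 2 + eps - `|x - z| ^+ 2.
have delta_gt0 : 0 < delta by rewrite subr_gt0.
have xz_ge : D ^+ 2 <= `|x - z| ^+ 2.
  by rewrite ler_sqr ?nnegrE//; exact: dist_set_le.
pose tau := Num.sqrt delta.
have tau_gt0 : 0 < tau by rewrite sqrtr_gt0.
have tau2 : tau ^+ 2 = delta by rewrite sqr_sqrtr// ltW.
have [|q [v [mq Sv qv]]] :=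
  nearest_point_dense ip_norm (2^-1 *: (x + z)) S0 Scl (tau := tau / 2).
  by rewrite divr_gt0.
pose y := q - (x - q).
have zy : `|z - y| < tau.
  have -> : z - y = 2 *: (2^-1 *: (x + z) - q).
    rewrite scalerBr scalerA divff ?pnatr_eq0// scale1r /y opprB scaler_nat mulr2n.
    by rewrite opprD -!addrA; exact: addrCA.
  by rewrite normrZ gtr0_norm// mulrC -ltr_pdivlMr.
have sumE w : `|x - w| ^+ 2 + `|y - w| ^+ 2 =
    2 * `|q - w| ^+ 2 + 2 * `|x - q| ^+ 2.
  have -> : x - w = (q - w) + (x - q) by rewrite [RHS]addrC addrA subrK.
  have -> : y - w = (q - w) - (x - q) by rewrite /y addrAC.
  by rewrite (sqr_norm_add ip_norm) (sqr_norm_sub ip_norm (q - w)); ring.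
have sum_le : `|x - v| ^+ 2 + `|y - v| ^+ 2 <= `|x - z| ^+ 2 + `|y - z| ^+ 2.
  rewrite !sumE lerD2r ler_pM2l// ler_sqr ?nnegrE//.
  exact: le_trans qv (dist_set_le q Sz).
have yz2 : `|y - z| ^+ 2 < delta.
  by rewrite -tau2 ltr_sqr ?nnegrE ?(ltW tau_gt0)// distrC.
have xv_ge : D ^+ 2 <= `|x - v| ^+ 2.
  by rewrite ler_sqr ?nnegrE//; exact: dist_set_le.
have yv : `|y - v| < l.
  rewrite -ltr_sqr ?nnegrE ?(ltW l_gt0)// l2; move: yz2; rewrite /delta; lra.
have xv2 : `|x - v| ^+ 2 < D ^+ 2 + eps.
  by have := sqr_ge0 `|y - v|; move: yz2; rewrite /delta; lra.
have xv : `|x - v| < D + l.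
  by rewrite -ltr_sqr ?nnegrE// ?addr_ge0 ?(ltW l_gt0)//; nra.
have tau_le : tau <= l by rewrite ler_wsqrtr// /delta; lra.
have zv : `|z - v| < 2 * l by have := ler_distD y z v; lra.
set c := 4 * l + D; have c_gt0 : 0 < c by rewrite /c; lra.
have sumv : 2 *: (q - v) = (x - v) + (y - v).
  rewrite /y scaler_nat mulr2n opprB addrACA [RHS]addrACA; congr (_ + _).
  by rewrite addrCA subrKC.
(* [2 (q - v)] has norm less than [d_S(x) + 2 l], hence at most [c]. *)
exists v, ((2 / c) *: (q - v)); split=> //.
  apply: prox_subdiff_dist_set => //; first by rewrite divr_ge0// ltW.
  rewrite mulrC -scalerA sumv normrZ gtr0_norm ?invr_gt0// mulrC.
  rewrite ler_pdivrMr// mul1r; apply: le_trans (ler_normD _ _) _.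
  by rewrite /c; lra.
rewrite scalerA mulrC divfK ?gt_eqF// sumv.
have -> : x - z - (x - v + (y - v)) = (v - z) - (y - v).
  by rewrite opprD addrA opprB; congr (_ - _); rewrite addrC addrA subrK.
by apply: le_trans (ler_normB _ _) _; rewrite (distrC v); lra.
Qed.

(* A real Hilbert space: a complete normed space whose norm comes from the
   inner product [ip] (bilinear, symmetric, positive definite). *)
Theorem lemma2p8 (R : realType) (H : completeNormedModType R)
    (ip : {dot H for idfun}) (ip_norm : forall u : H, ip u u = `|u| ^+ 2)
    (S : set H) (S_nonempty : S !=set0) (S_closed : closed S)
    (x : H) (eps eta : R) (eps_gt0 : 0 < eps) (eta_gt0 : 0 < eta)
    (Seta : set H) (Seta_approx : is_approx S eta Seta) :
  let eps' :=
    eps + 2 * eta * (dist_set S x + Num.sqrt eps) + eta ^+ 2 in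
  forall z : H, proj_eps_eta S Seta eps x z ->
    exists v : H, [/\ proj_eps S eps' x v,
      `|z - v| < 2 * Num.sqrt eps' + eta &
      set_add
        (set_scale (4 * Num.sqrt eps' + dist_set S x)
           (prox_subdiff ip (EFin \o dist_set S) v))
        (set_scale (3 * Num.sqrt eps' + eta) (unit_ball H))
        (x - z)].
Proof.
move=> eps' z [Seta_z xz].
have D_ge0 := dist_set_ge0 x S_nonempty.
have r_ge0 := sqrtr_ge0 eps.
have r2 : Num.sqrt eps ^+ 2 = eps by rewrite sqr_sqrtr// ltW.
have eps'_gt0 : 0 < eps' by rewrite /eps'; nra.
have [_ _ /(_ z Seta_z)[z0 Sz0 [_ [b + <-] z0b]]] := Seta_approx.
rewrite /unit_ball closed_ballE//= /closed_ball_ /= sub0r normrN => b_le1.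
have zz0 : `|z - z0| <= eta.
  by rewrite -z0b [z0 + _]addrC addrK normrZ gtr0_norm// ger_pMr.
have xz_lt : `|x - z| < dist_set S x + Num.sqrt eps.
  by rewrite -ltr_sqr ?nnegrE ?addr_ge0//; nra.
(* This is the estimate for which [eps'] is defined. *)
have xz0 : `|x - z0| ^+ 2 < dist_set S x ^+ 2 + eps'.
  have : `|x - z0| ^+ 2 <= (`|x - z| + eta) ^+ 2.
    rewrite ler_sqr ?nnegrE ?addr_ge0 ?(ltW eta_gt0)//.
    by have := ler_distD z x z0; lra.
  by rewrite /eps'; nra.
have [v [zeta [xv z0v zetaP res]]] :=
  proj_eps_prox_subdiff ip_norm S_closed eps'_gt0 (conj Sz0 xz0).
exists v; split=> //; first by have := ler_distD z0 z v; lra.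
set c := 4 * _ + _ in res *; set k := 3 * _ + _.
have k_gt0 : 0 < k by rewrite /k; have := sqrtr_ge0 eps'; lra.
exists (c *: zeta); first by exists zeta.
exists (x - z - c *: zeta); last by rewrite addrC subrK.
exists (k^-1 *: (x - z - c *: zeta)); last first.
  by rewrite scalerA divff ?gt_eqF// scale1r.
rewrite /= sub0r normrN.
rewrite normrZ gtr0_norm ?invr_gt0// mulrC ler_pdivrMr// mul1r.
have -> : x - z - c *: zeta = (x - z0 - c *: zeta) - (z - z0).
  by rewrite opprB addrACA addrA [x - z0 + z0]subrK addrAC.
by apply: le_trans (ler_normB _ _) _; rewrite /k; lra.
Qed.
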